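(* Let $\varsigma,\tau,\delta\in\mathbb{T}$ with $|\operatorname{Im}_j(\varsigma)|<\operatorname{Re}(\varsigma)$ and $|\operatorname{Im}_j(\tau)|<\operatorname{Re}(\tau)$. The bicomplex Prabhakar function satisfies the bicomplex Cauchy--Riemann equations: writing $\zeta=z_1+i_2z_2$ with $z_1,z_2\in\mathbb{C}$ and $\mathbb{E}^{\delta}_{\varsigma,\tau}(\zeta)=f_1(z_1,z_2)+i_2f_2(z_1,z_2)$ with $f_1,f_2$ complex-valued, one has $$\frac{\partial f_1}{\partial z_1}=\frac{\partial f_2}{\partial z_2}\qquad\text{and}\qquad \frac{\partial f_2}{\partial z_1}=-\frac{\partial f_1}{\partial z_2}.$$
   Context: $\mathbb{T}=\{x_0+i_1x_1+i_2x_2+jx_3: x_0,\dots,x_3\in\mathbb{R}\}$ is the commutative algebra of bicomplex numbers, with $i_1^2=i_2^2=-1$, $j=i_1i_2=i_2i_1$, $j^2=1$; write $\operatorname{Re}=x_0$, $\operatorname{Im}_j=x_3$. $\mathbb{C}$ is identified with $\{x_0+i_1x_1\}$, so $\mathbb{T}=\{w_1+i_2w_2:w_1,w_2\in\mathbb{C}\}$. With $e_1=\frac{1+i_1i_2}{2}$, $e_2=\frac{1-i_1i_2}{2}$, every $\xi=w_1+i_2w_2$ is uniquely $\xi=\xi_1e_1+\xi_2e_2$ with $\xi_1=w_1-i_1w_2$, $\xi_2=w_1+i_1w_2\in\mathbb{C}$; algebraic operations, limits and $\Gamma$ are componentwise, $\Gamma(\xi)=\Gamma(\xi_1)e_1+\Gamma(\xi_2)e_2$.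 The bicomplex Prabhakar function is $$\mathbb{E}_{\varsigma,\tau}^{\delta}(\zeta)=\sum_{k=0}^{\infty}\frac{(\delta)_k}{k!\,\Gamma(\varsigma k+\tau)}\zeta^k,\qquad (\delta)_k=\delta(\delta+1)\cdots(\delta+k-1),\ (\delta)_0=1.$$ The partial derivatives are complex derivatives with respect to the complex variables $z_1,z_2$. *)

(* Defs.v *)
From Stdlib Require Import Reals Factorial.
From Coquelicot Require Import Coquelicot.

Open Scope R_scope.

(** * Complex limits and the complex Gamma function *)

Definition CLim_seq (u : nat -> C) : C :=
  (real (Lim_seq (fun n => Re (u n))), real (Lim_seq (fun n => Im (u n)))).

Definition CSeries (a : nat -> C) : C :=
  (Series (fun n => Re (a n)), Series (fun n => Im (a n))).

(* [t ^ z = exp (z ln t)] with the real logarithm; meaningful for [0 < t]. *)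
Definition RCpower (t : R) (z : C) : C :=
  (RtoC (exp (Re z * ln t)) * (cos (Im z * ln t), sin (Im z * ln t)))%C.

Fixpoint Cpochhammer (z : C) (k : nat) : C :=
  match k with
  | O => RtoC 1
  | S m => (Cpochhammer z m * (z + RtoC (INR m)))%C
  end.

(* Euler-Gauss form of Gamma, on the whole plane:
   [Gamma z = lim_n n! n^z / (z (z+1) ... (z+n))].  At a pole, totality of the
   inverse ([/ 0 = 0]) yields the value 0, hence [/ CGamma z = 0] there. *)
Definition CGamma (z : C) : C :=
  CLim_seq (fun n =>
    (RtoC (INR (fact n)) * RCpower (INR n) z / Cpochhammer z (S n))%C).

(** * Bicomplex numbers *)

(* [BC w1 w2] is [w1 + i2 w2]; with [w1 = x0 + i1 x1] and [w2 = x2 + i1 x3] it is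
   [x0 + i1 x1 + i2 x2 + j x3]. *)
Record bicomplex : Type := BC { bc_w1 : C; bc_w2 : C }.

Declare Scope bc_scope.
Delimit Scope bc_scope with BC.
Bind Scope bc_scope with bicomplex.

Definition bc_Re (x : bicomplex) : R := Re (bc_w1 x).
Definition bc_Imj (x : bicomplex) : R := Im (bc_w2 x).

Definition bc_of_C (w : C) : bicomplex := BC w (RtoC 0).

Definition bc_of_nat (k : nat) : bicomplex := bc_of_C (RtoC (INR k)).

Definition bc_i2 : bicomplex := BC (RtoC 0) (RtoC 1).

Definition bc_plus (x y : bicomplex) : bicomplex :=
  BC (bc_w1 x + bc_w1 y)%C (bc_w2 x + bc_w2 y)%C.

Definition bc_mult (x y : bicomplex) : bicomplex :=
  BC (bc_w1 x * bc_w1 y - bc_w2 x * bc_w2 y)%C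
     (bc_w1 x * bc_w2 y + bc_w2 x * bc_w1 y)%C.

Infix "+" := bc_plus : bc_scope.
Infix "*" := bc_mult : bc_scope.

(* [(1 + i1 i2) / 2] and [(1 - i1 i2) / 2], using [i1 i2 = BC 0 i1]. *)
Definition bc_e1 : bicomplex := BC (RtoC (1 / 2)) (RtoC (1 / 2) * Ci)%C.
Definition bc_e2 : bicomplex := BC (RtoC (1 / 2)) (- (RtoC (1 / 2) * Ci))%C.

Definition bc_pr1 (x : bicomplex) : C := (bc_w1 x - Ci * bc_w2 x)%C.
Definition bc_pr2 (x : bicomplex) : C := (bc_w1 x + Ci * bc_w2 x)%C.

Definition bc_of_pr (a b : C) : bicomplex :=
  (bc_of_C a * bc_e1 + bc_of_C b * bc_e2)%BC.

(* Total; the genuine quotient when both components of [y] are nonzero, i.e. when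
   [y] is not a zero divisor. *)
Definition bc_div (x y : bicomplex) : bicomplex :=
  bc_of_pr (bc_pr1 x / bc_pr1 y)%C (bc_pr2 x / bc_pr2 y)%C.

Infix "/" := bc_div : bc_scope.

Fixpoint bc_pow (x : bicomplex) (k : nat) : bicomplex :=
  match k with
  | O => bc_of_nat 1
  | S m => (x * bc_pow x m)%BC
  end.

Infix "^" := bc_pow : bc_scope.

Fixpoint bc_pochhammer (x : bicomplex) (k : nat) : bicomplex :=
  match k with
  | O => bc_of_nat 1
  | S m => (bc_pochhammer x m * (x + bc_of_nat m))%BC
  end.

Definition bc_Gamma (x : bicomplex) : bicomplex :=
  bc_of_pr (CGamma (bc_pr1 x)) (CGamma (bc_pr2 x)).

Definition bc_Series (a : nat -> bicomplex) : bicomplex :=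
  bc_of_pr (CSeries (fun n => bc_pr1 (a n))) (CSeries (fun n => bc_pr2 (a n))).

Definition bc_Prabhakar (sigma tau delta zeta : bicomplex) : bicomplex :=
  bc_Series (fun k =>
    (bc_pochhammer delta k
       / (bc_of_nat (fact k) * bc_Gamma (sigma * bc_of_nat k + tau))
       * zeta ^ k)%BC).

(* Main.v *)
(** In idempotent components the Prabhakar series splits into two complex power
    series, [zeta = z1 + i2 z2] having components [z1 - i1 z2] and [z1 + i1 z2], and
    the hypotheses say that [sigma] and [tau] have components with positive real part.
    Once the two sums [F1], [F2] are known to be entire, the equations follow from
    [f1 = (F1 + F2) / 2], [f2 = i1 (F1 - F2) / 2] and the chain rule.

    For entireness, the Gauss product gives, for [x = Re z > 0], [y = Im z] and any
    [m >= 1],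
    [m^x <= |Gamma z| |z| exp (y^2 / (2x)) (1 + x)^m].
    On a sector [|y| <= K x], letting [m] be large makes [1 / |Gamma z|] smaller than
    [B exp (- A x)] for any prescribed [A], while [(delta)_k / k!] grows at most
    geometrically.  Since [Gamma] is defined by a total limit operator, the convergence
    of the Gauss product has to be established too. *)

Require Import Defs.
From Stdlib Require Import Reals Factorial Lra Lia.
From Coquelicot Require Import Coquelicot.

(** * Complex power series with infinite radius of convergence *)

Lemma Cmod_le_abs (z : C) : Cmod z <= Rabs (Re z) + Rabs (Im z).
Proof.
  pose proof (Rabs_pos (Re z)); pose proof (Rabs_pos (Im z)).
  apply Rsqr_incr_0_var; [|lra].
  rewrite !Rsqr_pow2, Cmod2_alt.
  rewrite <- (pow2_abs (Re z)), <- (pow2_abs (Im z)). nra.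
Qed.

Lemma im_le_Cmod (z : C) : Rabs (Im z) <= Cmod z.
Proof. apply Rle_trans with (2 := Rmax_Cmod z), Rmax_r. Qed.

Lemma ex_series_Re (u : nat -> C) (b : nat -> R) :
  (forall k, Cmod (u k) <= b k) -> ex_series b ->
  ex_series (fun k => Re (u k)).
Proof.
  intros u_le b_sum; apply @ex_series_le with (2 := b_sum); intros k.
  apply Rle_trans with (2 := u_le k), re_le_Cmod.
Qed.

Lemma ex_series_Im (u : nat -> C) (b : nat -> R) :
  (forall k, Cmod (u k) <= b k) -> ex_series b ->
  ex_series (fun k => Im (u k)).
Proof.
  intros u_le b_sum; apply @ex_series_le with (2 := b_sum); intros k.
  apply Rle_trans with (2 := u_le k), im_le_Cmod.
Qed.

Lemma Rabs_Series_le (f b : nat -> R) :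
  (forall k, Rabs (f k) <= b k) -> ex_series b -> Rabs (Series f) <= Series b.
Proof.
  intros Hf b_sum.
  apply Rle_trans with (Series (fun k => Rabs (f k))).
  - apply Series_Rabs, @ex_series_le with (2 := b_sum); intros k.
    change (Rabs (Rabs (f k)) <= b k). rewrite Rabs_Rabsolu; auto.
  - apply Series_le; auto. intros k; split; auto using Rabs_pos.
Qed.

(** The factor 2 arises because [CSeries] sums real and imaginary parts separately, and each of the
    two sums is at most [Series b]. *)
Lemma Cmod_CSeries_le (u : nat -> C) (b : nat -> R) :
  (forall k, Cmod (u k) <= b k) -> ex_series b ->
  Cmod (CSeries u) <= 2 * Series b.
Proof.
  intros u_le b_sum; apply Rle_trans with (1 := Cmod_le_abs _); simpl.
  assert (Rabs (Series (fun k => Re (u k))) <= Series b).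
  { apply Rabs_Series_le; auto; intros k.
    apply Rle_trans with (2 := u_le k), re_le_Cmod. }
  assert (Rabs (Series (fun k => Im (u k))) <= Series b).
  { apply Rabs_Series_le; auto; intros k.
    apply Rle_trans with (2 := u_le k), im_le_Cmod. }
  lra.
Qed.

(** This is the shape of a first-order Taylor remainder. Since [Series] is total, linearity has to
    come from the convergence that the three majorants provide. *)
Lemma CSeries_lin (u v w : nat -> C) (b c d : nat -> R) (h : C) :
  (forall k, Cmod (u k) <= b k) -> ex_series b ->
  (forall k, Cmod (v k) <= c k) -> ex_series c ->
  (forall k, Cmod (w k) <= d k) -> ex_series d ->
  CSeries (fun k => u k - v k - h * w k)%C
  = (CSeries u - CSeries v - h * CSeries w)%C.
Proof.
  intros Hu Hb Hv Hc Hw Hd.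
  pose proof (ex_series_Re u b Hu Hb). pose proof (ex_series_Im u b Hu Hb).
  pose proof (ex_series_Re v c Hv Hc). pose proof (ex_series_Im v c Hv Hc).
  pose proof (ex_series_Re w d Hw Hd). pose proof (ex_series_Im w d Hw Hd).
  pose proof (ex_series_scal_l (Re h) _ H3); pose proof (ex_series_scal_l (Im h) _ H3).
  pose proof (ex_series_scal_l (Re h) _ H4); pose proof (ex_series_scal_l (Im h) _ H4).
  apply injective_projections; unfold CSeries, Re, Im in *; simpl;
    match goal with |- ?l = ?p + - ?q + - ?s => change (l = p - q - s) end.
  - rewrite <- !Series_scal_l.
    rewrite <- (Series_minus (fun n => fst h * fst (w n)) (fun n => snd h * snd (w n))) by assumption.
    rewrite <- (Series_minus (fun n => fst (u n))) by assumption.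
    rewrite <- (Series_minus (fun n => fst (u n) - fst (v n))); cycle 1.
    { now apply (ex_series_minus (fun n => fst (u n)) (fun n => fst (v n))). }
    { now apply (ex_series_minus (fun n => fst h * fst (w n)) (fun n => snd h * snd (w n))). }
    apply Series_ext; intros n; simpl; ring.
  - rewrite <- !Series_scal_l.
    rewrite <- (Series_plus (fun n => fst h * snd (w n)) (fun n => snd h * fst (w n))) by assumption.
    rewrite <- (Series_minus (fun n => snd (u n))) by assumption.
    rewrite <- (Series_minus (fun n => snd (u n) - snd (v n))); cycle 1.
    { now apply (ex_series_minus (fun n => snd (u n)) (fun n => snd (v n))). }
    { now apply (ex_series_plus (fun n => fst h * snd (w n)) (fun n => snd h * fst (w n))). }
    apply Series_ext; intros n; simpl; ring.
Qed.

(** The remainders satisfy [R_(k+1) = (w + h) R_k + h^2 k w^(k-1)], and [k^2 + k <= (k+1)^2] closes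
    the induction. At [k = 0] the value of [pred] is harmless, its coefficient being 0. *)
Lemma Cpow_taylor2 (w h : C) (r : R) (k : nat) :
  1 <= r -> Cmod w <= r -> Cmod (w + h) <= r ->
  Cmod ((w + h) ^ k - w ^ k - h * (RtoC (INR k) * w ^ pred k))%C
  <= Cmod h ^ 2 * (INR k ^ 2 * r ^ k).
Proof.
  intros Hr Hw Hwh.
  induction k as [|k IH].
  { simpl. replace (_ - _ - _)%C with (RtoC 0) by ring. rewrite Cmod_0; lra. }
  replace ((w + h) ^ S k - w ^ S k - h * (RtoC (INR (S k)) * w ^ pred (S k)))%C
    with ((w + h) * ((w + h) ^ k - w ^ k - h * (RtoC (INR k) * w ^ pred k))
          + h * h * (RtoC (INR k) * w ^ pred k))%C; cycle 1.
  { rewrite S_INR, RtoC_plus. destruct k; simpl pred; rewrite ?Cpow_S; [simpl|]; ring. }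
  apply Rle_trans with (1 := Cmod_triangle _ _).
  rewrite !Cmod_mult, Cmod_R, Cmod_pow, (Rabs_pos_eq (INR k)) by apply pos_INR.
  pose proof (Cmod_ge_0 h) as Hh. pose proof (Cmod_ge_0 w) as Hw0.
  pose proof (Cmod_ge_0 (w + h)) as Hwh0.
  pose proof (pos_INR k) as Hk.
  assert (Hrk : 0 < r ^ k) by (apply pow_lt; lra).
  (* Deliberately generous, by [1 <= r]: the exponent [S k] is the one in the target bound. *)
  assert (Cmod w ^ pred k <= r * r ^ k).
  { change (r * r ^ k) with (r ^ S k).
    apply Rle_trans with (r ^ pred k).
    - apply pow_incr; lra.
    - apply Rle_pow; [lra|lia]. }
  set (D := Cmod (_ - _ - _)) in *.
  assert (0 <= D) by apply Cmod_ge_0.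
  apply Rle_trans with
    (r * (Cmod h ^ 2 * (INR k ^ 2 * r ^ k)) + Cmod h ^ 2 * (INR k * (r * r ^ k))).
  - apply Rplus_le_compat; [apply Rmult_le_compat; auto|].
    replace (Cmod h * Cmod h) with (Cmod h ^ 2) by ring.
    apply Rmult_le_compat_l; [nra|]. now apply Rmult_le_compat_l.
  - rewrite S_INR. simpl (r ^ S k).
    assert (0 <= Cmod h ^ 2) by nra.
    assert (0 <= Cmod h ^ 2 * (r * r ^ k)) by (apply Rmult_le_pos; nra).
    nra.
Qed.

(** Infinite radius of convergence, encoded as boundedness of the terms at every radius; this is
    easier to verify than summability and implies it. *)
Definition entire_coeffs (a : nat -> C) : Prop :=
  forall r, 0 < r -> exists B, forall k, Cmod (a k) * r ^ k <= B.

Lemma entire_coeffs_summable (a : nat -> C) (r : R) :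
  entire_coeffs a -> 0 < r -> ex_series (fun k => Cmod (a k) * r ^ k).
Proof.
  (* Boundedness at the doubled radius leaves a geometric majorant of ratio 1/2 at radius [r]. *)
  intros Ha Hr. destruct (Ha (2 * r)) as [B HB]; [lra|].
  apply @ex_series_le with (fun k => B * (/ 2) ^ k).
  - intros k. change (norm ?x) with (Rabs x).
    assert (0 < r ^ k) by now apply pow_lt.
    rewrite Rabs_pos_eq by (apply Rmult_le_pos; [apply Cmod_ge_0|lra]).
    replace (Cmod (a k) * r ^ k) with (Cmod (a k) * (2 * r) ^ k * (/ 2) ^ k).
    + apply Rmult_le_compat_r; auto. apply pow_le; lra.
    + rewrite Rmult_assoc, <- Rpow_mult_distr. do 2 f_equal; field.
  - apply (ex_series_scal_l B (fun k => (/ 2) ^ k)), ex_series_geom.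
    rewrite Rabs_pos_eq; lra.
Qed.

Lemma INR_le_pow2 (k : nat) : INR k <= 2 ^ k.
Proof.
  induction k; simpl pow; [simpl; lra|].
  rewrite S_INR. assert (1 <= 2 ^ k) by (apply pow_R1_Rle; lra). lra.
Qed.

Definition power_sum (a : nat -> C) (w : C) : C := CSeries (fun k => a k * w ^ k)%C.

(* The quadratic remainder bound is stable under affine substitutions, so that the chain rule is not needed later. *)
Lemma power_sum_taylor (a : nat -> C) (w : C) :
  entire_coeffs a ->
  exists L M, 0 <= M /\ forall h, Cmod h <= 1 ->
    Cmod (power_sum a (w + h) - power_sum a w - h * L)%C <= M * Cmod h ^ 2.
Proof.
  intros Ha.
  set (r := Cmod w + 1). assert (Hr : 1 <= r) by (pose proof (Cmod_ge_0 w); unfold r; lra).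
  (* The radius [4 * r] absorbs the factors [k <= 2^k] and [k^2 <= 4^k], so that one majorant serves
     both values, the termwise derivative and the remainder. *)
  set (b := fun k => Cmod (a k) * (4 * r) ^ k).
  assert (Hb : ex_series b) by (apply entire_coeffs_summable; auto; lra).
  assert (Hb0 : forall k, 0 <= b k).
  { intros k. apply Rmult_le_pos; [apply Cmod_ge_0|apply pow_le; lra]. }
  assert (Hpow : forall v k, Cmod v <= r -> Cmod (a k * v ^ k)%C <= b k).
  { intros v k Hv. rewrite Cmod_mult, Cmod_pow.
    apply Rmult_le_compat_l; [apply Cmod_ge_0|].
    apply pow_incr; split; [apply Cmod_ge_0|lra]. }
  exists (CSeries (fun k => a k * (RtoC (INR k) * w ^ pred k))%C), (2 * Series b).
  split.
  { assert (0 <= Series b); [|lra].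
    apply Rle_trans with (1 := Rabs_pos (Series b)), Rabs_Series_le; auto.
    intros k; rewrite Rabs_pos_eq; auto with real. }
  intros h Hh.
  assert (Hw : Cmod w <= r) by (unfold r; lra).
  assert (Hwh : Cmod (w + h) <= r).
  { apply Rle_trans with (1 := Cmod_triangle _ _); unfold r; lra. }
  unfold power_sum. rewrite <- (CSeries_lin _ _ _ b b b); auto; cycle 1.
  { intros k. rewrite !Cmod_mult, Cmod_R, Cmod_pow, Rabs_pos_eq by apply pos_INR.
    apply Rmult_le_compat_l; [apply Cmod_ge_0|].
    replace (4 * r) with (2 * (2 * r)) by ring.
    rewrite (Rpow_mult_distr 2).
    apply Rmult_le_compat; [apply pos_INR|apply pow_le, Cmod_ge_0|apply INR_le_pow2|].
    apply Rle_trans with ((2 * r) ^ pred k).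
    - apply pow_incr; split; [apply Cmod_ge_0|lra].
    - apply Rle_pow; [lra|lia]. }
  rewrite Rmult_assoc, (Rmult_comm (Series b)), <- Series_scal_l.
  apply Cmod_CSeries_le; [|now apply (ex_series_scal_l (Cmod h ^ 2) b)].
  intros k.
  replace (a k * (w + h) ^ k - a k * w ^ k - h * (a k * (RtoC (INR k) * w ^ pred k)))%C
    with (a k * ((w + h) ^ k - w ^ k - h * (RtoC (INR k) * w ^ pred k)))%C by ring.
  rewrite Cmod_mult.
  apply Rle_trans with (Cmod (a k) * (Cmod h ^ 2 * (INR k ^ 2 * r ^ k))).
  - apply Rmult_le_compat_l; [apply Cmod_ge_0|]. now apply Cpow_taylor2.
  - unfold b. replace (Cmod (a k) * (Cmod h ^ 2 * (INR k ^ 2 * r ^ k)))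
      with (Cmod h ^ 2 * (Cmod (a k) * (INR k ^ 2 * r ^ k))) by ring.
    apply Rmult_le_compat_l; [apply pow2_ge_0|].
    apply Rmult_le_compat_l; [apply Cmod_ge_0|].
    rewrite (Rpow_mult_distr 4). apply Rmult_le_compat_r; [apply pow_le; lra|].
    replace 4 with (2 * 2) by ring. rewrite Rpow_mult_distr.
    pose proof (INR_le_pow2 k). pose proof (pos_INR k). nra.
Qed.

Lemma Csub_add (z y : C) : y = (z + (y - z))%C.
Proof. ring. Qed.

Lemma is_derive_of_taylor (f : C -> C) (z L : C) (M : R) :
  0 <= M ->
  (forall h, Cmod h <= 1 -> Cmod (f (z + h) - f z - h * L)%C <= M * Cmod h ^ 2) ->
  is_derive (K := C_AbsRing) (V := C_NormedModule) f z L.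
Proof.
  intros HM Hf. split; [apply is_linear_scal_l|].
  intros x Hx. apply (is_filter_lim_locally_unique (V := AbsRing_NormedModule C_AbsRing)) in Hx. subst x.
  intros eps.
  pose proof (cond_pos eps) as He.
  (* The bound 1 makes the Taylor hypothesis applicable; [M + 1] avoids a division by zero when
     [M = 0]. *)
  assert (Hd : 0 < Rmin 1 (eps / (M + 1))).
  { apply Rmin_pos; [lra|]. apply Rdiv_lt_0_compat; lra. }
  apply (locally_le_locally_norm (V := AbsRing_NormedModule C_AbsRing)).
  exists (mkposreal _ Hd). intros y Hy.
  change (Cmod (y - z)%C < Rmin 1 (eps / (M + 1))) in Hy.
  change (Cmod (f y - f z - (y - z) * L)%C <= eps * Cmod (y - z)%C).
  set (h := (y - z)%C) in *.
  assert (Hyz : y = (z + h)%C) by apply Csub_add.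
  rewrite Hyz.
  pose proof (Rmin_l 1 (eps / (M + 1))). pose proof (Rmin_r 1 (eps / (M + 1))).
  apply Rle_trans with (1 := Hf h ltac:(lra)).
  pose proof (Cmod_ge_0 h).
  replace (M * Cmod h ^ 2) with (M * Cmod h * Cmod h) by ring.
  apply Rmult_le_compat_r; auto.
  apply Rle_trans with ((M + 1) * (eps / (M + 1))); [apply Rmult_le_compat; lra|].
  right; field; lra.
Qed.

(** * The Gauss product *)

Definition Gamma_seq (z : C) (n : nat) : C :=
  (RtoC (INR (fact n)) * RCpower (INR n) z / Cpochhammer z (S n))%C.

Lemma exp_le (x y : R) : x <= y -> exp x <= exp y.
Proof. intros [H| ->]; [left; now apply exp_increasing|lra]. Qed.

Lemma exp_polar_add (v1 v2 w1 w2 : R) :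
  (RtoC (exp (v1 + v2)) * (cos (w1 + w2), sin (w1 + w2))
   = RtoC (exp v1) * (cos w1, sin w1) * (RtoC (exp v2) * (cos w2, sin w2)))%C.
Proof.
  rewrite exp_plus, cos_plus, sin_plus.
  apply injective_projections; simpl; ring.
Qed.

Lemma Cmod_exp_polar (v w : R) :
  Cmod (RtoC (exp v) * (cos w, sin w))%C = exp v.
Proof.
  rewrite Cmod_mult, Cmod_R, Rabs_pos_eq by (left; apply exp_pos).
  unfold Cmod; simpl. rewrite !Rmult_1_r.
  pose proof (sin2_cos2 w) as E; unfold Rsqr in E.
  rewrite Rplus_comm, E, sqrt_1; ring.
Qed.

Lemma Re_add_pos_neq0 (z : C) (n : nat) : 0 < Re z -> (z + RtoC (INR n))%C <> RtoC 0.
Proof.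
  intros Hz E. apply (f_equal Re) in E. pose proof (pos_INR n).
  unfold Re in *; simpl in E. lra.
Qed.

Lemma Cpochhammer_neq0 (z : C) (n : nat) : 0 < Re z -> Cpochhammer z n <> RtoC 0.
Proof.
  intros Hz. induction n as [|n IH]; simpl.
  - intros E; apply RtoC_inj in E; lra.
  - apply Cmult_neq_0; auto. now apply Re_add_pos_neq0.
Qed.

(** * Lower bound on Gamma *)

(** This is [(x+1)...(x+n) / n!], the real Pochhammer product without its first factor, normalised
    by the factorial of the Gauss product. *)
Fixpoint rising (x : R) (n : nat) : R :=
  match n with
  | O => 1
  | S m => rising x m * (1 + x / INR (S m))
  end.

Lemma rising_pos (x : R) (n : nat) : 0 < x -> 0 < rising x n.
Proof.
  intros Hx; induction n as [|n IH]; [simpl; lra|].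
  cbn [rising]. apply Rmult_lt_0_compat; auto.
  assert (0 < INR (S n)) by (apply lt_0_INR; lia).
  assert (0 < x / INR (S n)) by now apply Rdiv_lt_0_compat.
  lra.
Qed.

Lemma rising_le_pow (x : R) (n : nat) : 0 < x -> rising x n <= (1 + x) ^ n.
Proof.
  intros Hx; induction n as [|n IH]; [simpl; lra|].
  cbn [rising]. simpl pow. rewrite (Rmult_comm (1 + x)).
  assert (1 <= INR (S n)) by (rewrite S_INR; pose proof (pos_INR n); lra).
  assert (x / INR (S n) <= x).
  { apply Rle_div_l; [lra|]. nra. }
  assert (0 < x / INR (S n)) by (apply Rdiv_lt_0_compat; lra).
  pose proof (rising_pos x n Hx).
  apply Rmult_le_compat; lra.
Qed.

(** Both bounds are [ln t <= t - 1], taken at [n / (n+1)] and at [(n+1) / n]. *)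
Lemma ln_succ_bounds (n : nat) : (1 <= n)%nat ->
  / INR (S n) <= ln (INR (S n)) - ln (INR n) <= / INR n.
Proof.
  intros Hn.
  assert (0 < INR n) by (apply lt_0_INR; lia).
  assert (0 < INR (S n)) by (apply lt_0_INR; lia).
  rewrite <- ln_div by assumption.
  assert (ln_le_sub1 : forall t, 0 < t -> ln t <= t - 1).
  { intros t Ht. pose proof (exp_ineq1_le (ln t)) as E.
    rewrite exp_ln in E by assumption. lra. }
  split.
  - assert (E : ln (INR (S n) / INR n) = - ln (INR n / INR (S n))).
    { rewrite !ln_div by assumption. ring. }
    rewrite E.
    pose proof (ln_le_sub1 (INR n / INR (S n)) ltac:(now apply Rdiv_lt_0_compat)) as L.
    replace (INR n / INR (S n) - 1) with (- / INR (S n)) in L; [lra|].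
    rewrite S_INR in *. field. lra.
  - apply Rle_trans with (1 := ln_le_sub1 (INR (S n) / INR n) ltac:(now apply Rdiv_lt_0_compat)).
    right. rewrite S_INR. field. lra.
Qed.

(** Each factor beyond [m] obeys [1 + x/k <= exp (x/k) <= exp (x (ln k - ln (k-1)))], and the
    exponents telescope. Starting at [m] keeps it as a free parameter. *)
Lemma rising_le_exp (x : R) (m n : nat) : 0 < x -> (1 <= m <= n)%nat ->
  rising x n <= rising x m * exp (x * (ln (INR n) - ln (INR m))).
Proof.
  intros Hx [Hm Hmn]. induction Hmn as [|n Hmn IH].
  - rewrite Rminus_diag, Rmult_0_r, exp_0. lra.
  - cbn [rising].
    replace (x * (ln (INR (S n)) - ln (INR m)))
      with (x * (ln (INR n) - ln (INR m)) + x * (ln (INR (S n)) - ln (INR n))) by ring.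
    rewrite exp_plus, <- Rmult_assoc.
    destruct (ln_succ_bounds n) as [L _]; [lia|].
    assert (0 < INR (S n)) by (apply lt_0_INR; lia).
    assert (0 < x / INR (S n)) by now apply Rdiv_lt_0_compat.
    apply Rmult_le_compat; auto; [left; now apply rising_pos|lra|].
    apply Rle_trans with (2 := exp_ineq1_le _).
    apply Rplus_le_compat_l. unfold Rdiv. apply Rmult_le_compat_l; lra.
Qed.

(** With [X = Re z + n + 1], the squared modulus is [X^2 (1 + y^2 / X^2)]. Replacing [1 / X^2] by
    the larger [1/(X-1) - 1/X] makes the exponents telescope in the product over [n]. *)
Lemma Cmod_add_nat_le (z : C) (n : nat) : 0 < Re z ->
  Cmod (z + RtoC (INR (S n)))%C
  <= (Re z + INR (S n))
     * exp (Im z ^ 2 / 2 * (/ (Re z + INR n) - / (Re z + INR (S n)))).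
Proof.
  intros Hx. pose proof (pos_INR n) as Hn. rewrite S_INR.
  set (d := / (Re z + INR n) - / (Re z + (INR n + 1))).
  assert (Hd : / (Re z + (INR n + 1)) ^ 2 <= d).
  { replace d with (/ ((Re z + INR n) * (Re z + (INR n + 1)))) by (unfold d; field; lra).
    apply Rinv_le_contravar; nra. }
  set (X := Re z + (INR n + 1)) in *.
  assert (HX : 0 < X) by (unfold X; lra).
  pose proof (exp_pos (Im z ^ 2 / 2 * d)).
  apply Rsqr_incr_0_var; [|nra].
  rewrite !Rsqr_pow2, Cmod2_alt, Rpow_mult_distr.
  replace (exp (Im z ^ 2 / 2 * d) ^ 2) with (exp (Im z ^ 2 * d)); cycle 1.
  { rewrite <- (Rsqr_pow2 (exp _)). unfold Rsqr. rewrite <- exp_plus. f_equal; field. }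
  replace (Re (z + RtoC (INR n + 1))) with X by reflexivity.
  replace (Im (z + RtoC (INR n + 1))) with (Im z) by (unfold Im; simpl; ring).
  apply Rle_trans with (X ^ 2 * (1 + Im z ^ 2 * d)).
  - apply Rmult_le_compat_l with (r := X ^ 2) in Hd; [|nra].
    rewrite Rinv_r in Hd by nra.
    pose proof (pow2_ge_0 (Im z)). nra.
  - apply Rmult_le_compat_l; [nra|]. apply exp_ineq1_le.
Qed.

Lemma Cmod_Cpochhammer_le (z : C) (n : nat) : 0 < Re z ->
  Cmod (Cpochhammer z (S n))
  <= INR (fact n) * rising (Re z) n
     * (Cmod z * exp (Im z ^ 2 / 2 * (/ Re z - / (Re z + INR n)))).
Proof.
  intros Hx. induction n as [|n IH].
  - simpl. rewrite Rplus_0_r, Rminus_diag, Rmult_0_r, exp_0.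
    rewrite Cplus_0_r, Cmult_1_l. lra.
  - change (Cpochhammer z (S (S n)))
      with (Cpochhammer z (S n) * (z + RtoC (INR (S n))))%C.
    rewrite Cmod_mult.
    apply Rle_trans with (1 := Rmult_le_compat _ _ _ _ (Cmod_ge_0 _) (Cmod_ge_0 _)
                                 IH (Cmod_add_nat_le z n Hx)).
    right. rewrite fact_simpl, mult_INR. cbn [rising].
    replace (Im z ^ 2 / 2 * (/ Re z - / (Re z + INR (S n))))
      with (Im z ^ 2 / 2 * (/ Re z - / (Re z + INR n))
            + Im z ^ 2 / 2 * (/ (Re z + INR n) - / (Re z + INR (S n)))) by ring.
    rewrite exp_plus. field. apply not_0_INR; lia.
Qed.

(** Write [n^x = m^x (n/m)^x]: the factor [(n/m)^x] cancels the growth of the denominator beyond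
    [m], which leaves a bound independent of [n]. *)
Lemma Gamma_seq_lower (z : C) (m n : nat) : 0 < Re z -> (1 <= m <= n)%nat ->
  exp (Re z * ln (INR m))
  <= Cmod (Gamma_seq z n)
     * (Cmod z * exp (Im z ^ 2 / (2 * Re z)) * (1 + Re z) ^ m).
Proof.
  intros Hx Hmn. unfold Gamma_seq.
  rewrite Cmod_div, Cmod_mult by now apply Cpochhammer_neq0.
  unfold RCpower. rewrite Cmod_exp_polar, Cmod_R, Rabs_pos_eq by apply pos_INR.
  pose proof (Cmod_Cpochhammer_le z n Hx) as HP.
  assert (HP0 : 0 < Cmod (Cpochhammer z (S n))).
  { apply Cmod_gt_0. now apply Cpochhammer_neq0. }
  set (P := Cmod (Cpochhammer z (S n))) in *.
  pose proof (INR_fact_lt_0 n) as Hf.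
  pose proof (pos_INR n) as Hn.
  pose proof (Cmod_ge_0 z) as Hz.
  set (W := Cmod z * _ * _).
  replace (INR (fact n) * exp (Re z * ln (INR n)) / P * W)
    with (INR (fact n) * exp (Re z * ln (INR n)) * W / P) by (field; lra).
  apply Rle_div_r; [assumption|].
  replace (ln (INR n)) with (ln (INR m) + (ln (INR n) - ln (INR m))) by ring.
  rewrite Rmult_plus_distr_l, exp_plus.
  set (E := exp (Re z * (ln (INR n) - ln (INR m)))).
  replace (INR (fact n) * (exp (Re z * ln (INR m)) * E) * W)
    with (exp (Re z * ln (INR m)) * (INR (fact n) * E * W)) by ring.
  apply Rmult_le_compat_l; [left; apply exp_pos|].
  apply Rle_trans with (1 := HP). rewrite !(Rmult_assoc (INR (fact n))).
  apply Rmult_le_compat_l; [lra|].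
  replace (E * W) with ((1 + Re z) ^ m * E * (Cmod z * exp (Im z ^ 2 / (2 * Re z))))
    by (unfold W; ring).
  apply Rmult_le_compat.
  - left; now apply rising_pos.
  - apply Rmult_le_pos; [assumption|left; apply exp_pos].
  - apply Rle_trans with (1 := rising_le_exp _ m n Hx Hmn).
    apply Rmult_le_compat_r; [left; apply exp_pos|]. now apply rising_le_pow.
  - apply Rmult_le_compat_l; [assumption|]. apply exp_le.
    replace (Im z ^ 2 / (2 * Re z)) with (Im z ^ 2 / 2 * / Re z) by (field; lra).
    apply Rmult_le_compat_l; [pose proof (pow2_ge_0 (Im z)); lra|].
    assert (0 < / (Re z + INR n)) by (apply Rinv_0_lt_compat; lra). lra.
Qed.

(** * Convergence of the Gauss product *)

(** The sequences [p - c] and [p + c] are adjacent: the first increases, the second decreases, and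
    their gap [2 c] tends to 0. *)
Lemma ex_lim_seq_telescope (p c : nat -> R) :
  (forall n, Rabs (p (S n) - p n) <= c n - c (S n)) ->
  is_lim_seq c 0 -> ex_finite_lim_seq p.
Proof.
  intros Hp Hc.
  destruct (ex_lim_seq_adj (fun n => p n - c n) (fun n => p n + c n)) as [[l Hl] _].
  - intros n. specialize (Hp n). apply Rabs_le_between in Hp. lra.
  - intros n. specialize (Hp n). apply Rabs_le_between in Hp. lra.
  - apply is_lim_seq_ext with (fun n => c n + c n); [intros; ring|].
    replace (Finite 0) with (Finite (0 + 0)) by (f_equal; ring).
    now apply is_lim_seq_plus'.
  - exists (l + 0).
    apply is_lim_seq_ext with (fun n => p n - c n + c n); [intros; ring|].
    now apply is_lim_seq_plus'.
Qed.

Lemma inv_sq_le_telescope (n : nat) :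
  / INR (S n) ^ 2 <= 2 * / INR (S n) - 2 * / INR (S (S n)).
Proof.
  rewrite !S_INR. pose proof (pos_INR n).
  replace (2 * / (INR n + 1) - 2 * / (INR n + 1 + 1))
    with (/ ((INR n + 1) * ((INR n + 1 + 1) / 2))) by (field; lra).
  apply Rinv_le_contravar; nra.
Qed.

(** Since [1/n^2] is summable, the product of the factors [1 + K/n^2] bounds the moduli by a
    constant [B]. The relative increments then become absolute ones, dominated by a telescoping null
    sequence. *)
Lemma ex_lim_of_relative_increments (a : nat -> C) (K : R) :
  0 <= K ->
  (forall n, Cmod (a (S n) - a n)%C <= K / INR (S n) ^ 2 * Cmod (a n)) ->
  ex_finite_lim_seq (fun n => Re (a n)) /\ ex_finite_lim_seq (fun n => Im (a n)).
Proof.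
  intros HK Ha.
  assert (Hinc : forall n, 0 <= K / INR (S n) ^ 2
                   <= K * (2 * / INR (S n) - 2 * / INR (S (S n)))).
  { intros n. assert (0 < INR (S n) ^ 2) by (apply pow_lt, lt_0_INR; lia). split.
    - apply Rmult_le_pos; [assumption|]. left; now apply Rinv_0_lt_compat.
    - apply Rmult_le_compat_l; [assumption|]. apply inv_sq_le_telescope. }
  assert (Hb : forall n, Cmod (a n) <= Cmod (a O) * exp (K * (2 - 2 * / INR (S n)))).
  { intros n; induction n as [|n IH].
    - simpl INR. replace (K * (2 - 2 * / 1)) with 0 by field. rewrite exp_0; lra.
    - replace (K * (2 - 2 * / INR (S (S n))))
        with (K * (2 - 2 * / INR (S n)) + K * (2 * / INR (S n) - 2 * / INR (S (S n)))) by ring.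
      rewrite exp_plus, <- Rmult_assoc.
      apply Rle_trans with (Cmod (a n) * (1 + K / INR (S n) ^ 2)).
      + rewrite (Csub_add (a n) (a (S n))).
        apply Rle_trans with (1 := Cmod_triangle _ _). specialize (Ha n). lra.
      + destruct (Hinc n). apply Rmult_le_compat; auto using Cmod_ge_0; [lra|].
        apply Rle_trans with (2 := exp_ineq1_le _). lra. }
  set (B := Cmod (a O) * exp (K * 2)).
  assert (HB : forall n, Cmod (a n) <= B).
  { intros n. apply Rle_trans with (1 := Hb n).
    apply Rmult_le_compat_l; [apply Cmod_ge_0|]. apply exp_le.
    apply Rmult_le_compat_l; [assumption|].
    assert (0 < / INR (S n)) by (apply Rinv_0_lt_compat, lt_0_INR; lia). lra. }
  set (c := fun n => B * K * 2 * / INR (S n)).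
  assert (Hc : is_lim_seq c 0).
  { replace (Finite 0) with (Rbar_mult (B * K * 2) 0) by (simpl; f_equal; ring).
    apply is_lim_seq_scal_l.
    apply (is_lim_seq_incr_1 (fun n => / INR n)).
    replace (Finite 0) with (Rbar_inv p_infty) by reflexivity.
    apply is_lim_seq_inv; [apply is_lim_seq_INR|discriminate]. }
  assert (Hd : forall n, Cmod (a (S n) - a n)%C <= c n - c (S n)).
  { intros n. apply Rle_trans with (1 := Ha n). destruct (Hinc n).
    unfold c.
    replace (_ - _) with (K * (2 * / INR (S n) - 2 * / INR (S (S n))) * B) by ring.
    apply Rmult_le_compat; auto using Cmod_ge_0. }
  split; apply ex_lim_seq_telescope with (2 := Hc); intros n;
    apply Rle_trans with (2 := Hd n).
  - apply (re_le_Cmod (a (S n) - a n)%C).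
  - apply (im_le_Cmod (a (S n) - a n)%C).
Qed.

Lemma Rabs_sin_le (w : R) : Rabs (sin w) <= Rabs w.
Proof.
  destruct (MVT_gen sin 0 w cos) as [t [_ E]].
  - intros; auto_derive; auto; ring.
  - intros; apply continuity_sin.
  - rewrite sin_0, !Rminus_0_r in E. rewrite E, Rabs_mult.
    pose proof (COS_bound t). pose proof (Rabs_pos w).
    assert (Rabs (cos t) <= 1) by (apply Rabs_le; lra). nra.
Qed.

(** By the half-angle formula [cos w - 1 = - 2 s^2] with [s = sin (w/2)]. Using [|s| <= |w|/2] twice
    gives the quadratic bound, using it once together with [|s| <= 1] the linear one. *)
Lemma Rabs_cos_sub1 (w : R) : Rabs (cos w - 1) <= w ^ 2 / 2 /\ Rabs (cos w - 1) <= Rabs w.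
Proof.
  replace w with (2 * (w / 2)) at 1 3 by field. rewrite cos_2a_sin.
  set (s := sin (w / 2)).
  assert (Hs : Rabs s <= Rabs w / 2).
  { replace (Rabs w / 2) with (Rabs (w / 2)); [apply Rabs_sin_le|].
    rewrite Rabs_div, (Rabs_pos_eq 2); lra. }
  assert (H1 : Rabs s <= 1).
  { pose proof (SIN_bound (w / 2)). apply Rabs_le; fold s in H; lra. }
  replace (1 - 2 * s * s - 1) with (- (2 * s ^ 2)) by ring.
  rewrite Rabs_Ropp, Rabs_pos_eq, <- (pow2_abs s), <- (pow2_abs w)
    by (pose proof (pow2_ge_0 s); lra).
  pose proof (Rabs_pos s). split; nra.
Qed.

Lemma Rabs_sin_sub (w : R) : Rabs (sin w - w) <= w ^ 2.
Proof.
  destruct (MVT_gen (fun t => sin t - t) 0 w (fun t => cos t - 1)) as [t [Ht E]].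
  - intros; auto_derive; auto; ring.
  - intros x _. apply continuity_pt_minus; [apply continuity_sin|apply continuity_pt_id].
  - rewrite sin_0, !Rminus_0_r in E. rewrite E, Rabs_mult, <- (pow2_abs w).
    destruct (Rabs_cos_sub1 t) as [_ H].
    assert (Rabs t <= Rabs w).
    { unfold Rmin, Rmax in Ht. destruct (Rle_dec 0 w).
      - rewrite !Rabs_pos_eq; lra.
      - rewrite !Rabs_left1; lra. }
    pose proof (Rabs_pos w). simpl. rewrite Rmult_1_r.
    apply Rmult_le_compat_r; lra.
Qed.

(** Second-order remainder of the complex exponential at [v + i1 w]. Each component splits into a
    remainder in [v] and a trigonometric one in [w]; for [v >= 0] the constants are absorbed by
    [exp v >= 1]. *)
Lemma exp_polar_taylor (v w : R) : 0 <= v ->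
  Cmod (RtoC (exp v) * (cos w, sin w) - 1 - (v, w))%C <= 2 * exp v * (v ^ 2 + w ^ 2).
Proof.
  intros Hv.
  (* This is [1 - v <= exp (- v)] multiplied by [exp v]. *)
  assert (H1 : exp v - 1 <= v * exp v).
  { pose proof (exp_ineq1_le (- v)) as E. pose proof (exp_pos v).
    assert (exp v * exp (- v) = 1) by (rewrite <- exp_plus, Rplus_opp_r; apply exp_0).
    nra. }
  pose proof (exp_ineq1_le v) as H0.
  assert (H2 : exp v - 1 - v <= v ^ 2 * exp v) by nra.
  destruct (Rabs_cos_sub1 w) as [Hc _].
  pose proof (Rabs_sin_sub w) as Hs. pose proof (Rabs_sin_le w) as Hs'.
  assert (Hc1 : Rabs (cos w) <= 1) by (pose proof (COS_bound w); apply Rabs_le; lra).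
  apply Rle_trans with (1 := Cmod_le_abs _).
  replace (Re _) with ((exp v - 1 - v) * cos w + (1 + v) * (cos w - 1))
    by (unfold Re; simpl; ring).
  replace (Im _) with ((exp v - 1) * sin w + (sin w - w)) by (unfold Im; simpl; ring).
  assert (HR : Rabs ((exp v - 1 - v) * cos w + (1 + v) * (cos w - 1))
               <= exp v * (v ^ 2 + w ^ 2 / 2)).
  { apply Rle_trans with (1 := Rabs_triang _ _). rewrite !Rabs_mult.
    rewrite (Rabs_pos_eq (exp v - 1 - v)), (Rabs_pos_eq (1 + v)) by lra.
    assert ((exp v - 1 - v) * Rabs (cos w) <= v ^ 2 * exp v).
    { apply Rle_trans with ((exp v - 1 - v) * 1); [apply Rmult_le_compat_l|]; lra. }
    assert ((1 + v) * Rabs (cos w - 1) <= exp v * (w ^ 2 / 2)).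
    { apply Rmult_le_compat; auto using Rabs_pos; lra. }
    lra. }
  assert (HI : Rabs ((exp v - 1) * sin w + (sin w - w))
               <= exp v * (v ^ 2 / 2 + 3 * w ^ 2 / 2)).
  { apply Rle_trans with (1 := Rabs_triang _ _). rewrite Rabs_mult.
    rewrite (Rabs_pos_eq (exp v - 1)) by lra.
    assert ((exp v - 1) * Rabs (sin w) <= v * exp v * Rabs w).
    { apply Rmult_le_compat; auto using Rabs_pos; lra. }
    assert (v * Rabs w <= v ^ 2 / 2 + w ^ 2 / 2).
    { rewrite <- (pow2_abs w). pose proof (pow2_ge_0 (v - Rabs w)). nra. }
    assert (1 * w ^ 2 <= exp v * w ^ 2).
    { apply Rmult_le_compat_r; [apply pow2_ge_0|lra]. }
    pose proof (exp_pos v). nra. }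
  pose proof (Rmult_le_pos _ _ (Rlt_le _ _ (exp_pos v)) (pow2_ge_0 v)). lra.
Qed.

(** Here [Q] is [((n+1)/n)^z], and consecutive terms have ratio [(n+1) Q / (z+n+1)]. *)
Lemma Gamma_seq_succ (z : C) (n : nat) : 0 < Re z ->
  let u := ln (INR (S n)) - ln (INR n) in
  let Q := (RtoC (exp (Re z * u)) * (cos (Im z * u), sin (Im z * u)))%C in
  (Gamma_seq z (S n) - Gamma_seq z n
   = Gamma_seq z n * (RtoC (INR (S n)) * (Q - 1) - z) / (z + RtoC (INR (S n))))%C.
Proof.
  intros Hz u Q.
  assert (E : RCpower (INR (S n)) z = (RCpower (INR n) z * Q)%C).
  { unfold RCpower, Q. rewrite <- exp_polar_add, <- !Rmult_plus_distr_l.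
    now replace (ln (INR n) + u) with (ln (INR (S n))) by (unfold u; ring). }
  unfold Gamma_seq. rewrite E.
  change (Cpochhammer z (S (S n)))
    with (Cpochhammer z (S n) * (z + RtoC (INR (S n))))%C.
  rewrite fact_simpl, mult_INR, RtoC_mult.
  pose proof (Cpochhammer_neq0 z (S n) Hz). pose proof (Re_add_pos_neq0 z (S n) Hz).
  field; auto.
Qed.

(** To first order [Q - 1] is [z u] and [u] is [1/(n+1)], so [(n+1)(Q - 1) - z] is [n+1] times an
    error of order [1/n^2]; the denominator, of modulus at least [n+1], removes the factor [n+1]. *)
Lemma Gamma_seq_increment (z : C) : 0 < Re z ->
  exists K, 0 <= K /\ forall n, (1 <= n)%nat ->
    Cmod (Gamma_seq z (S n) - Gamma_seq z n)%C <= K / INR n ^ 2 * Cmod (Gamma_seq z n).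
Proof.
  intros Hz.
  (* The first summand bounds the Taylor error of [Q], by [u <= 1/n <= 1]; the second comes from
     [|u - 1/(n+1)| <= 1/n^2]. *)
  exists (2 * exp (Re z) * Cmod z ^ 2 + Cmod z). split.
  { pose proof (exp_pos (Re z)). pose proof (Cmod_ge_0 z). nra. }
  intros n Hn. rewrite Gamma_seq_succ by assumption.
  destruct (ln_succ_bounds n Hn) as [Hu1 Hu2].
  set (u := ln (INR (S n)) - ln (INR n)) in *.
  set (Q := (RtoC (exp (Re z * u)) * (cos (Im z * u), sin (Im z * u)))%C).
  assert (Hn1 : 1 <= INR n) by (change 1 with (INR 1); now apply le_INR).
  rewrite S_INR in *. set (N := INR n) in *.
  assert (HN1 : 0 < / (N + 1)) by (apply Rinv_0_lt_compat; lra).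
  assert (HNinv : 0 < / N <= 1).
  { split; [apply Rinv_0_lt_compat; lra|]. rewrite <- Rinv_1.
    apply Rinv_le_contravar; lra. }
  assert (HzN := Re_add_pos_neq0 z (S n) Hz). rewrite S_INR in HzN. fold N in HzN.
  assert (Hden : N + 1 <= Cmod (z + RtoC (N + 1))%C).
  { apply Rle_trans with (2 := re_le_Cmod _). unfold Re in *; simpl.
    rewrite Rabs_pos_eq; lra. }
  assert (Hzu : (Re z * u, Im z * u) = (z * RtoC u)%C).
  { apply injective_projections; unfold Re, Im; simpl; ring. }
  assert (HT : Cmod (Q - 1 - z * RtoC u)%C <= 2 * exp (Re z) * Cmod z ^ 2 * / N ^ 2).
  { rewrite <- Hzu.
    apply Rle_trans with (1 := exp_polar_taylor (Re z * u) (Im z * u) ltac:(nra)).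
    replace ((Re z * u) ^ 2 + (Im z * u) ^ 2) with (Cmod z ^ 2 * u ^ 2)
      by (rewrite Cmod2_alt; ring).
    rewrite <- Rmult_assoc.
    assert (exp (Re z * u) <= exp (Re z)) by (apply exp_le; nra).
    assert (0 <= Cmod z ^ 2) by apply pow2_ge_0.
    rewrite <- pow_inv.
    pose proof (exp_pos (Re z * u)).
    apply Rmult_le_compat; [nra|nra|nra|]. apply pow_incr; lra. }
  assert (HU : Rabs (u - / (N + 1)) <= / N ^ 2).
  { rewrite Rabs_pos_eq by lra.
    apply Rle_trans with (/ N - / (N + 1)); [lra|].
    replace (/ N - / (N + 1)) with (/ (N * (N + 1))) by (field; lra).
    apply Rinv_le_contravar; nra. }
  unfold Cdiv. rewrite !Cmod_mult, Cmod_inv by assumption.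
  replace (RtoC (N + 1) * (Q - 1) - z)%C
    with (RtoC (N + 1) * ((Q - 1 - z * RtoC u) + z * RtoC (u - / (N + 1))))%C; cycle 1.
  { rewrite RtoC_minus, RtoC_inv by lra.
    assert (RtoC (N + 1) <> RtoC 0) by (intros E; apply RtoC_inj in E; lra). field; auto. }
  rewrite Cmod_mult, Cmod_R, Rabs_pos_eq by lra.
  set (D := Cmod (z + _)%C) in *.
  set (T := Cmod (Q - 1 - z * RtoC u + _)%C).
  assert (T <= (2 * exp (Re z) * Cmod z ^ 2 + Cmod z) / N ^ 2).
  { apply Rle_trans with (1 := Cmod_triangle _ _).
    rewrite (Cmod_mult z (RtoC (u - _))), Cmod_R.
    unfold Rdiv. rewrite Rmult_plus_distr_r. apply Rplus_le_compat; auto.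
    apply Rmult_le_compat_l; auto using Cmod_ge_0. }
  rewrite Rmult_comm with (r2 := Cmod (Gamma_seq z n)), Rmult_assoc.
  apply Rmult_le_compat_l; [apply Cmod_ge_0|].
  apply Rle_trans with T; auto.
  assert (0 <= T) by apply Cmod_ge_0.
  replace ((N + 1) * T * / D) with ((N + 1) * T / D) by reflexivity.
  apply Rle_div_l; [lra|]. nra.
Qed.

Lemma CGamma_lower (z : C) (m : nat) : 0 < Re z -> (1 <= m)%nat ->
  exp (Re z * ln (INR m))
  <= Cmod (CGamma z) * (Cmod z * exp (Im z ^ 2 / (2 * Re z)) * (1 + Re z) ^ m).
Proof.
  intros Hz Hm.
  destruct (Gamma_seq_increment z Hz) as [K [HK Hinc]].
  (* The shift by one is forced: the increment bound starts at [n = 1]. *)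
  destruct (ex_lim_of_relative_increments (fun n => Gamma_seq z (S n)) K HK)
    as [[p Hp] [q Hq]].
  { intros n. apply Hinc; lia. }
  apply (is_lim_seq_incr_1 (fun n => Re (Gamma_seq z n))) in Hp.
  apply (is_lim_seq_incr_1 (fun n => Im (Gamma_seq z n))) in Hq.
  assert (E : CGamma z = (p, q)).
  { unfold CGamma, CLim_seq.
    apply injective_projections.
    - change (real (Lim_seq (fun n => Re (Gamma_seq z n))) = p).
      rewrite (is_lim_seq_unique _ _ Hp). reflexivity.
    - change (real (Lim_seq (fun n => Im (Gamma_seq z n))) = q).
      rewrite (is_lim_seq_unique _ _ Hq). reflexivity. }
  rewrite E.
  set (W := Cmod z * _ * _).
  assert (HW : 0 < W).
  { unfold W. repeat apply Rmult_lt_0_compat; [|apply exp_pos|apply pow_lt; lra].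
    apply Cmod_gt_0. intros E0. rewrite E0 in Hz. unfold Re in Hz; simpl in Hz; lra. }
  apply Rle_div_l; [assumption|].
  set (e := exp _ / W).
  assert (He : 0 < e) by (apply Rdiv_lt_0_compat; auto using exp_pos).
  (* The squared modulus is a polynomial in the real and imaginary parts, whose limits are known. *)
  apply Rsqr_incr_0_var; [|apply Cmod_ge_0].
  rewrite !Rsqr_pow2, Cmod2_alt.
  apply (is_lim_seq_le_loc (fun _ => e ^ 2)
           (fun n => Re (Gamma_seq z n) * Re (Gamma_seq z n)
                     + Im (Gamma_seq z n) * Im (Gamma_seq z n))
           (e ^ 2) (Re (p, q) ^ 2 + Im (p, q) ^ 2)).
  - exists m. intros n Hn.
    replace (_ + _) with (Cmod (Gamma_seq z n) ^ 2) by (rewrite Cmod2_alt; ring).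
    apply pow_incr; split; [lra|].
    apply Rle_div_l; [assumption|]. apply Gamma_seq_lower; auto; lia.
  - apply is_lim_seq_const.
  - simpl. rewrite !Rmult_1_r. apply is_lim_seq_plus'; now apply is_lim_seq_mult'.
Qed.

(** * Exponential decay of the reciprocal Gamma function on sectors *)

Lemma ln_unbounded (A : R) : exists m, (1 <= m)%nat /\ A <= ln (INR m).
Proof.
  destruct (nfloor_ex (exp A)) as [m [_ Hm]]; [left; apply exp_pos|].
  exists (S m). split; [lia|].
  rewrite <- (ln_exp A) at 1. apply ln_le; [apply exp_pos|].
  rewrite S_INR; lra.
Qed.


(** Raise [1 + x <= m (1 + x/m) <= m exp (x/m)] to the power [m]. *)
Lemma pow_le_exp (x : R) (m : nat) : 0 <= x -> (1 <= m)%nat ->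
  (1 + x) ^ m <= INR m ^ m * exp x.
Proof.
  intros Hx Hm.
  assert (Hm1 : 1 <= INR m) by (change 1 with (INR 1); now apply le_INR).
  assert (E : forall j, exp (x / INR m) ^ j = exp (INR j * (x / INR m))).
  { induction j as [|j IH]; [simpl; rewrite Rmult_0_l, exp_0; ring|].
    rewrite S_INR, Rmult_plus_distr_r, exp_plus, <- IH, Rmult_1_l. simpl; ring. }
  replace (exp x) with (exp (x / INR m) ^ m) by (rewrite E; f_equal; field; lra).
  rewrite <- Rpow_mult_distr. apply pow_incr; split; [lra|].
  apply Rle_trans with (INR m * (1 + x / INR m)).
  - replace (INR m * (1 + x / INR m)) with (INR m + x) by (field; lra). lra.
  - apply Rmult_le_compat_l; [lra|]. apply exp_ineq1_le.
Qed.

Lemma Cmod_inv_CGamma_le (K A : R) : 0 <= K ->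
  exists B, 0 <= B /\ forall z, 0 < Re z -> Rabs (Im z) <= K * Re z ->
    Cmod (/ CGamma z)%C <= B * exp (- A * Re z).
Proof.
  intros HK.
  (* The power [m^x] has to outweigh three exponentials: the prescribed rate [A], the rate 1 from
     [pow_le_exp], and [K^2 / 2] from the imaginary part on the sector. *)
  destruct (ln_unbounded (A + 1 + K ^ 2 / 2)) as [m [Hm Hln]].
  (* The exponent is [S m] because [Cmod z] contributes one more factor [1 + x]. *)
  set (P := INR (S m) ^ S m).
  assert (HP : 0 <= P) by (apply pow_le, pos_INR).
  exists ((1 + K) * P). split; [apply Rmult_le_pos; lra|].
  intros z Hz Hy. set (x := Re z) in *.
  pose proof (CGamma_lower z m Hz Hm) as HG. fold x in HG.
  pose proof (exp_pos (x * ln (INR m))) as Hexp.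
  assert (HG0 : CGamma z <> RtoC 0).
  { intros E. rewrite E, Cmod_0, Rmult_0_l in HG. lra. }
  rewrite Cmod_inv by assumption. apply Cmod_gt_0 in HG0.
  set (G := Cmod (CGamma z)) in *.
  assert (Hmod : Cmod z <= (1 + K) * (1 + x)).
  { apply Rle_trans with (1 := Cmod_le_abs z). fold x.
    rewrite (Rabs_pos_eq x); nra. }
  assert (Hq : exp (Im z ^ 2 / (2 * x)) <= exp (K ^ 2 / 2 * x)).
  { apply exp_le, Rle_div_l; [lra|]. rewrite <- (pow2_abs (Im z)).
    replace (K ^ 2 / 2 * x * (2 * x)) with ((K * x) ^ 2) by field.
    apply pow_incr; split; [apply Rabs_pos|assumption]. }
  assert (HW : Cmod z * exp (Im z ^ 2 / (2 * x)) * (1 + x) ^ m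
               <= (1 + K) * P * (exp x * exp (K ^ 2 / 2 * x))).
  { apply Rle_trans with ((1 + K) * (1 + x) * exp (K ^ 2 / 2 * x) * (1 + x) ^ m).
    - apply Rmult_le_compat_r; [apply pow_le; lra|].
      apply Rmult_le_compat; auto using Cmod_ge_0. left; apply exp_pos.
    - pose proof (pow_le_exp x (S m) ltac:(lra) ltac:(lia)) as Hpe. fold P in Hpe.
      simpl pow in Hpe.
      assert (0 <= (1 + K) * exp (K ^ 2 / 2 * x)).
      { apply Rmult_le_pos; [lra|left; apply exp_pos]. }
      nra. }
  set (W := Cmod z * _ * _) in *.
  assert (HE : exp x * exp (K ^ 2 / 2 * x) <= exp (- A * x) * exp (x * ln (INR m))).
  { rewrite <- !exp_plus. apply exp_le. nra. }
  apply Rmult_le_reg_r with (exp (x * ln (INR m))); [assumption|].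
  rewrite Rmult_assoc.
  apply Rle_trans with W.
  - rewrite Rmult_comm. apply Rle_div_l; [assumption|]. now rewrite (Rmult_comm W).
  - apply Rle_trans with (1 := HW). apply Rmult_le_compat_l; [|assumption].
    apply Rmult_le_pos; lra.
Qed.

(** * Prabhakar coefficients *)

Definition prabhakar_coeff (s t d : C) (k : nat) : C :=
  (Cpochhammer d k
   / (RtoC (INR (fact k)) * CGamma (s * RtoC (INR k) + t)))%C.

Lemma Cmod_Cpochhammer_le_fact (d : C) (k : nat) :
  Cmod (Cpochhammer d k) <= INR (fact k) * (1 + Cmod d) ^ k.
Proof.
  induction k as [|k IH].
  - simpl. rewrite Cmod_1. lra.
  - change (Cpochhammer d (S k)) with (Cpochhammer d k * (d + RtoC (INR k)))%C.
    rewrite Cmod_mult, fact_simpl, mult_INR, S_INR. simpl pow.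
    pose proof (Cmod_ge_0 d). pose proof (pos_INR k).
    assert (Cmod (d + RtoC (INR k))%C <= (INR k + 1) * (1 + Cmod d)).
    { apply Rle_trans with (1 := Cmod_triangle _ _).
      rewrite Cmod_R, Rabs_pos_eq by assumption. nra. }
    apply Rle_trans with (1 := Rmult_le_compat _ _ _ _ (Cmod_ge_0 _) (Cmod_ge_0 _) IH H1).
    right; ring.
Qed.

(** The convention [/ 0 = 0] makes the identity hold for zero factors too. *)
Lemma Cinv_mult (x y : C) : (/ (x * y) = / x * / y)%C.
Proof.
  assert (inv0 : (/ RtoC 0 = RtoC 0)%C).
  { apply injective_projections; simpl; unfold Rdiv; ring. }
  destruct (Ceq_dec x (RtoC 0)) as [->|Hx]; [now rewrite Cmult_0_l, inv0, Cmult_0_l|].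
  destruct (Ceq_dec y (RtoC 0)) as [->|Hy]; [now rewrite Cmult_0_r, inv0, Cmult_0_r|].
  field; auto.
Qed.

(** All arguments [s k + t] lie in one sector, of slope at most [Ks + Kt]. There the decay of
    [/ CGamma] can be chosen to beat the geometric growth [q^k] of the other factors. *)
Lemma prabhakar_entire (s t d : C) :
  0 < Re s -> 0 < Re t -> entire_coeffs (prabhakar_coeff s t d).
Proof.
  intros Hs Ht r Hr.
  set (q := (1 + Cmod d) * r).
  assert (Hq : 0 < q) by (pose proof (Cmod_ge_0 d); unfold q; nra).
  set (Ks := Rabs (Im s) / Re s). set (Kt := Rabs (Im t) / Re t).
  assert (HKs : 0 <= Ks) by (apply Rdiv_le_0_compat; auto using Rabs_pos).
  assert (HKt : 0 <= Kt) by (apply Rdiv_le_0_compat; auto using Rabs_pos).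
  assert (Es : Rabs (Im s) = Ks * Re s) by (unfold Ks; field; lra).
  assert (Et : Rabs (Im t) = Kt * Re t) by (unfold Kt; field; lra).
  (* As [Re z >= k Re s], the rate [q / Re s] gives at least [exp (- k q)], which compensates
     [q^k <= exp (k q)]. *)
  destruct (Cmod_inv_CGamma_le (Ks + Kt) (q / Re s)) as [B [HB Hinv]]; [lra|].
  exists B. intros k. pose proof (pos_INR k) as Hk.
  set (z := (s * RtoC (INR k) + t)%C).
  assert (Ez : Re z = Re s * INR k + Re t) by (unfold z, Re; simpl; ring).
  assert (Ez' : Im z = Im s * INR k + Im t) by (unfold z, Im; simpl; ring).
  assert (Hz : 0 < Re z) by (rewrite Ez; nra).
  assert (HI : Rabs (Im z) <= (Ks + Kt) * Re z).
  { rewrite Ez, Ez'. apply Rle_trans with (1 := Rabs_triang _ _).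
    rewrite Rabs_mult, (Rabs_pos_eq (INR k)), Es, Et by assumption.
    assert (0 <= Re s * INR k) by nra.
    pose proof (Rmult_le_pos _ _ HKt H). pose proof (Rmult_le_pos _ _ HKs (Rlt_le _ _ Ht)).
    lra. }
  pose proof (Hinv z Hz HI) as HG.
  assert (Hf : 0 < INR (fact k)) by apply INR_fact_lt_0.
  assert (Hc : Cmod (prabhakar_coeff s t d k) <= (1 + Cmod d) ^ k * (B * exp (- (q / Re s) * Re z))).
  { unfold prabhakar_coeff. fold z.
    replace (Cpochhammer d k / (RtoC (INR (fact k)) * CGamma z))%C
      with (RtoC (/ INR (fact k)) * Cpochhammer d k * / CGamma z)%C; cycle 1.
    { rewrite RtoC_inv by lra. unfold Cdiv. rewrite Cinv_mult. ring. }
    rewrite !Cmod_mult, Cmod_R, Rabs_pos_eq by (left; now apply Rinv_0_lt_compat).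
    apply Rmult_le_compat; auto using Cmod_ge_0.
    - apply Rmult_le_pos; [left; now apply Rinv_0_lt_compat|apply Cmod_ge_0].
    - rewrite Rmult_comm. apply Rle_div_l; [assumption|].
      rewrite Rmult_comm. apply Cmod_Cpochhammer_le_fact. }
  apply Rle_trans with ((1 + Cmod d) ^ k * (B * exp (- (q / Re s) * Re z)) * r ^ k).
  { apply Rmult_le_compat_r; [apply pow_le; lra|assumption]. }
  replace ((1 + Cmod d) ^ k * (B * exp (- (q / Re s) * Re z)) * r ^ k)
    with (B * (q ^ k * exp (- (q / Re s) * Re z)))
    by (unfold q; rewrite Rpow_mult_distr; ring).
  rewrite <- (Rmult_1_r B) at 2. apply Rmult_le_compat_l; [assumption|].
  assert (Hqk : q ^ k <= exp (INR k * q)).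
  { clear - Hq. induction k as [|k IH]; [simpl; rewrite Rmult_0_l, exp_0; lra|].
    rewrite S_INR, Rmult_plus_distr_r, Rplus_comm, exp_plus, Rmult_1_l. simpl pow.
    pose proof (exp_ineq1_le q).
    apply Rmult_le_compat; auto; [lra|apply pow_le; lra|lra]. }
  apply Rle_trans with (exp (INR k * q) * exp (- (q / Re s) * Re z)).
  { apply Rmult_le_compat_r; [left; apply exp_pos|assumption]. }
  rewrite <- exp_plus, <- exp_0. apply exp_le. rewrite Ez.
  replace (INR k * q + - (q / Re s) * (Re s * INR k + Re t)) with (- (q / Re s * Re t))
    by (field; lra).
  assert (0 < q / Re s) by now apply Rdiv_lt_0_compat. nra.
Qed.

(** * Idempotent components *)

(** Algebra homomorphisms onto the complex numbers; the two idempotent projections are treated alike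
    through this interface. *)
Definition bc_hom (p : bicomplex -> C) : Prop :=
  (forall x y, p (x + y)%BC = (p x + p y)%C) /\
  (forall x y, p (x * y)%BC = (p x * p y)%C) /\
  (forall w, p (bc_of_C w) = w).

Lemma bc_pr1_hom : bc_hom bc_pr1.
Proof.
  repeat split; intros; apply injective_projections; unfold bc_pr1; simpl; ring.
Qed.

Lemma bc_pr2_hom : bc_hom bc_pr2.
Proof.
  repeat split; intros; apply injective_projections; unfold bc_pr2; simpl; ring.
Qed.

Lemma bc_pr1_of_pr (a b : C) : bc_pr1 (bc_of_pr a b) = a.
Proof. apply injective_projections; unfold bc_pr1; simpl; field. Qed.

Lemma bc_pr2_of_pr (a b : C) : bc_pr2 (bc_of_pr a b) = b.
Proof. apply injective_projections; unfold bc_pr2; simpl; field. Qed.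

Lemma bc_hom_pow (p : bicomplex -> C) (x : bicomplex) (k : nat) :
  bc_hom p -> p (x ^ k)%BC = (p x ^ k)%C.
Proof.
  intros (Hp & Hm & Hc). induction k as [|k IH]; simpl.
  - apply Hc.
  - now rewrite Hm, IH.
Qed.

Lemma bc_hom_pochhammer (p : bicomplex -> C) (x : bicomplex) (k : nat) :
  bc_hom p -> p (bc_pochhammer x k) = Cpochhammer (p x) k.
Proof.
  intros (Hp & Hm & Hc). induction k as [|k IH]; simpl.
  - apply Hc.
  - rewrite Hm, Hp, IH. unfold bc_of_nat. now rewrite Hc.
Qed.

Lemma CSeries_ext (u v : nat -> C) : (forall k, u k = v k) -> CSeries u = CSeries v.
Proof.
  intros H. unfold CSeries; f_equal; apply Series_ext; intros k; now rewrite H.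
Qed.

Lemma bc_pr1_Prabhakar (s t d x : bicomplex) :
  bc_pr1 (bc_Prabhakar s t d x)
  = power_sum (prabhakar_coeff (bc_pr1 s) (bc_pr1 t) (bc_pr1 d)) (bc_pr1 x).
Proof.
  destruct bc_pr1_hom as (Hp & Hm & Hc).
  unfold bc_Prabhakar, bc_Series, power_sum. rewrite bc_pr1_of_pr.
  apply CSeries_ext; intros k. unfold bc_div, bc_Gamma, prabhakar_coeff, bc_of_nat.
  now rewrite Hm, (bc_hom_pow _ _ _ bc_pr1_hom), bc_pr1_of_pr,
    (bc_hom_pochhammer _ _ _ bc_pr1_hom), Hm, bc_pr1_of_pr, Hp, Hm, !Hc.
Qed.

Lemma bc_pr2_Prabhakar (s t d x : bicomplex) :
  bc_pr2 (bc_Prabhakar s t d x)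
  = power_sum (prabhakar_coeff (bc_pr2 s) (bc_pr2 t) (bc_pr2 d)) (bc_pr2 x).
Proof.
  destruct bc_pr2_hom as (Hp & Hm & Hc).
  unfold bc_Prabhakar, bc_Series, power_sum. rewrite bc_pr2_of_pr.
  apply CSeries_ext; intros k. unfold bc_div, bc_Gamma, prabhakar_coeff, bc_of_nat.
  now rewrite Hm, (bc_hom_pow _ _ _ bc_pr2_hom), bc_pr2_of_pr,
    (bc_hom_pochhammer _ _ _ bc_pr2_hom), Hm, bc_pr2_of_pr, Hp, Hm, !Hc.
Qed.

(** * Cauchy-Riemann equations *)

(** Covers all four partial derivatives, with slopes [c1], [c2] among 1, [Ci] and [- Ci]. Slopes of
    modulus 1 preserve [Cmod h], so the quadratic remainders simply add up. *)
Lemma is_derive_affine_comb (g F1 F2 : C -> C) (z w1 w2 a1 a2 c1 c2 L1 L2 : C) (M1 M2 : R) :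
  Cmod c1 = 1 -> Cmod c2 = 1 -> 0 <= M1 -> 0 <= M2 ->
  (forall h, Cmod h <= 1 -> Cmod (F1 (w1 + h) - F1 w1 - h * L1)%C <= M1 * Cmod h ^ 2) ->
  (forall h, Cmod h <= 1 -> Cmod (F2 (w2 + h) - F2 w2 - h * L2)%C <= M2 * Cmod h ^ 2) ->
  (forall h, g (z + h)%C = (a1 * F1 (w1 + c1 * h) + a2 * F2 (w2 + c2 * h))%C) ->
  is_derive (K := C_AbsRing) (V := C_NormedModule) g z (a1 * c1 * L1 + a2 * c2 * L2)%C.
Proof.
  intros Hc1 Hc2 HM1 HM2 H1 H2 Hg.
  pose proof (Cmod_ge_0 a1). pose proof (Cmod_ge_0 a2).
  apply is_derive_of_taylor with (Cmod a1 * M1 + Cmod a2 * M2); [nra|].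
  intros h Hh.
  assert (E1 : Cmod (c1 * h)%C = Cmod h) by (rewrite Cmod_mult, Hc1; ring).
  assert (E2 : Cmod (c2 * h)%C = Cmod h) by (rewrite Cmod_mult, Hc2; ring).
  specialize (H1 (c1 * h)%C). specialize (H2 (c2 * h)%C).
  rewrite E1 in H1; rewrite E2 in H2.
  specialize (H1 Hh); specialize (H2 Hh).
  assert (Hg0 : g z = (a1 * F1 w1 + a2 * F2 w2)%C).
  { specialize (Hg (RtoC 0)). now rewrite !Cmult_0_r, !Cplus_0_r in Hg. }
  rewrite Hg, Hg0.
  replace (_ - _ - _)%C
    with (a1 * (F1 (w1 + c1 * h) - F1 w1 - c1 * h * L1)
          + a2 * (F2 (w2 + c2 * h) - F2 w2 - c2 * h * L2))%C by ring.
  apply Rle_trans with (1 := Cmod_triangle _ _). rewrite !Cmod_mult.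
  rewrite Rmult_plus_distr_r, !Rmult_assoc.
  apply Rplus_le_compat; now apply Rmult_le_compat_l.
Qed.

Theorem theorem2p5 :
  forall (sigma tau delta : bicomplex) (f1 f2 : C -> C -> C),
    Rabs (bc_Imj sigma) < bc_Re sigma ->
    Rabs (bc_Imj tau) < bc_Re tau ->
    (forall z1 z2 : C,
       bc_Prabhakar sigma tau delta (bc_of_C z1 + bc_i2 * bc_of_C z2)%BC
       = (bc_of_C (f1 z1 z2) + bc_i2 * bc_of_C (f2 z1 z2))%BC) ->
    forall z1 z2 : C,
      ex_derive (K := C_AbsRing) (V := C_NormedModule) (fun z => f1 z z2) z1 /\
      ex_derive (K := C_AbsRing) (V := C_NormedModule) (fun z => f1 z1 z) z2 /\
      ex_derive (K := C_AbsRing) (V := C_NormedModule) (fun z => f2 z z2) z1 /\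
      ex_derive (K := C_AbsRing) (V := C_NormedModule) (fun z => f2 z1 z) z2 /\
      C_derive (fun z => f1 z z2) z1 = C_derive (fun z => f2 z1 z) z2 /\
      C_derive (fun z => f2 z z2) z1 = (- C_derive (fun z => f1 z1 z) z2)%C.
Proof.
  intros sigma tau delta f1 f2 Hsigma Htau Hf z1 z2.
  (* The components [bc_pr1] and [bc_pr2] have real parts [x0 + x3] and [x0 - x3], so the two halves
     of each absolute value bound are exactly their positivity. *)
  apply Rabs_lt_between in Hsigma, Htau. unfold bc_Imj, bc_Re, Re, Im in Hsigma, Htau.
  set (F1 := power_sum (prabhakar_coeff (bc_pr1 sigma) (bc_pr1 tau) (bc_pr1 delta))).
  set (F2 := power_sum (prabhakar_coeff (bc_pr2 sigma) (bc_pr2 tau) (bc_pr2 delta))).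
  assert (HF1 : forall u v, F1 (u - Ci * v)%C = (f1 u v - Ci * f2 u v)%C).
  { intros u v. pose proof (f_equal bc_pr1 (Hf u v)) as E.
    rewrite bc_pr1_Prabhakar in E. fold F1 in E.
    destruct bc_pr1_hom as (Hp & Hm & Hc). rewrite !Hp, !Hm, !Hc in E.
    replace (bc_pr1 bc_i2) with (- Ci)%C in E by (unfold bc_pr1; simpl; ring).
    replace (u - Ci * v)%C with (u + - Ci * v)%C by ring. rewrite E. ring. }
  assert (HF2 : forall u v, F2 (u + Ci * v)%C = (f1 u v + Ci * f2 u v)%C).
  { intros u v. pose proof (f_equal bc_pr2 (Hf u v)) as E.
    rewrite bc_pr2_Prabhakar in E. fold F2 in E.
    destruct bc_pr2_hom as (Hp & Hm & Hc). rewrite !Hp, !Hm, !Hc in E.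
    replace (bc_pr2 bc_i2) with Ci in E by (unfold bc_pr2; simpl; ring).
    exact E. }
  set (w1 := (z1 - Ci * z2)%C). set (w2 := (z1 + Ci * z2)%C).
  destruct (power_sum_taylor (prabhakar_coeff (bc_pr1 sigma) (bc_pr1 tau) (bc_pr1 delta)) w1)
    as (L1 & M1 & HM1 & HT1).
  { apply prabhakar_entire; unfold bc_pr1, Re; simpl; lra. }
  destruct (power_sum_taylor (prabhakar_coeff (bc_pr2 sigma) (bc_pr2 tau) (bc_pr2 delta)) w2)
    as (L2 & M2 & HM2 & HT2).
  { apply prabhakar_entire; unfold bc_pr2, Re; simpl; lra. }
  fold F1 in HT1. fold F2 in HT2.
  set (c := RtoC (/ 2)).
  (* With [c] and [Ci] kept as symbols, this relation and [c + c = 1] are what the inversion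
     formulas for [f1] and [f2] rest on. *)
  assert (CiCi : (Ci * Ci = - (1))%C) by (apply injective_projections; simpl; ring).
  assert (Ec : (c + c = 1)%C) by (apply injective_projections; simpl; field).
  assert (Ef1 : forall u v, f1 u v = (c * F1 (u - Ci * v) + c * F2 (u + Ci * v))%C).
  { intros u v. rewrite HF1, HF2.
    transitivity ((c + c) * f1 u v)%C; [rewrite Ec|]; ring. }
  assert (Ef2 : forall u v, f2 u v = (c * Ci * F1 (u - Ci * v) + - (c * Ci) * F2 (u + Ci * v))%C).
  { intros u v. rewrite HF1, HF2.
    transitivity (- (Ci * Ci) * (c + c) * f2 u v)%C; [rewrite Ec, CiCi|]; ring. }
  assert (Cmod_Ci' : Cmod (- Ci)%C = 1) by (rewrite Cmod_opp; apply Cmod_Ci).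
  assert (D11 : is_derive (K := C_AbsRing) (V := C_NormedModule)
                  (fun z => f1 z z2) z1 (c * 1 * L1 + c * 1 * L2)%C).
  { apply is_derive_affine_comb with F1 F2 w1 w2 M1 M2; auto using Cmod_1.
    intros h. rewrite Ef1. unfold w1, w2. do 3 f_equal; ring. }
  assert (D12 : is_derive (K := C_AbsRing) (V := C_NormedModule)
                  (fun z => f1 z1 z) z2 (c * - Ci * L1 + c * Ci * L2)%C).
  { apply is_derive_affine_comb with F1 F2 w1 w2 M1 M2; auto using Cmod_Ci.
    intros h. rewrite Ef1. unfold w1, w2. do 3 f_equal; ring. }
  assert (D21 : is_derive (K := C_AbsRing) (V := C_NormedModule)
                  (fun z => f2 z z2) z1 (c * Ci * 1 * L1 + - (c * Ci) * 1 * L2)%C).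
  { apply is_derive_affine_comb with F1 F2 w1 w2 M1 M2; auto using Cmod_1.
    intros h. rewrite Ef2. unfold w1, w2. do 3 f_equal; ring. }
  assert (D22 : is_derive (K := C_AbsRing) (V := C_NormedModule)
                  (fun z => f2 z1 z) z2 (c * Ci * - Ci * L1 + - (c * Ci) * Ci * L2)%C).
  { apply is_derive_affine_comb with F1 F2 w1 w2 M1 M2; auto using Cmod_Ci.
    intros h. rewrite Ef2. unfold w1, w2. do 3 f_equal; ring. }
  repeat split; try (eexists; eassumption).
  - apply (eq_trans (is_C_derive_unique _ _ _ D11)).
    refine (eq_trans _ (eq_sym (is_C_derive_unique _ _ _ D22))).
    (* In the [z2]-derivative of [f2], the coefficient [Ci] or [- Ci] meets the opposite slope, so
       both terms carry [- (Ci * Ci) = 1]. *)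
    transitivity (- (Ci * Ci) * (c * L1 + c * L2))%C; [rewrite CiCi|]; ring.
  - apply (eq_trans (is_C_derive_unique _ _ _ D21)).
    refine (eq_trans _ (eq_sym (f_equal Copp (is_C_derive_unique _ _ _ D12)))). ring.
Qed.
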